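(* Let $\mathbb{V}$ be an $n$-dimensional vector space ($n\ge 1$) over a finite field $\mathbb{F}$ with $q$ elements, with basis $\{\alpha_1,\ldots,\alpha_n\}$, and let $\Gamma(\mathbb{V})$ be its non-zero component graph with respect to this basis. If $q>2$, then $\Gamma(\mathbb{V})$ is Hamiltonian.
   Context: Let $\theta$ be the null vector of $\mathbb{V}$. Every $\mathbf{a}\in\mathbb{V}$ is written uniquely as $\mathbf{a}=a_1\alpha_1+\cdots+a_n\alpha_n$. The non-zero component graph $\Gamma(\mathbb{V})$ with respect to the basis $\{\alpha_1,\ldots,\alpha_n\}$ is the simple graph with vertex set $\mathbb{V}\setminus\{\theta\}$ in which two distinct vertices $\mathbf{a},\mathbf{b}$ are adjacent if and only if there is at least one $i$ such that the coefficients of $\alpha_i$ in $\mathbf{a}$ and in $\mathbf{b}$ are both non-zero. Following the paper's conventions: a path of length $k$ is an alternating sequence of vertices and edges $v_0,e_0,v_1,e_1,\ldots,v_{k-1},e_{k-1},v_k$ where the $v_i$ are distinct (except possibly the first and last vertices) and $e_i$ is the edge joining $v_i$ and $v_{i+1}$ (no distinctness of the edges is required, so $v_0,e,v_1,e,v_0$ is allowed); a cycle is a path whose first and last vertices are the same; a graph is Hamiltonian if it contains a cycle consisting of all its vertices. *)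

(* Defs.v *)
From HB Require Import structures.
From mathcomp Require Import all_boot all_order all_algebra.

Set Implicit Arguments.
Unset Strict Implicit.
Unset Printing Implicit Defensive.

Import GRing.Theory.
Local Open Scope ring_scope.

Record sgraph := SGraph {
  vertex :> eqType;
  adj : rel vertex;
  adj_sym : symmetric adj;
  adj_irrefl : irreflexive adj
}.

(* The sequence v_0, ..., v_k is represented by x = v_0 and s = [:: v_1; ...; v_k],
   so that k = size s; k = 0 is allowed. The edges are left implicit, since in a
   simple graph e_i is determined by v_i and v_{i+1}. Only vertices are required
   to be distinct, and v_0 = v_k is permitted: when a and b are adjacent,
   a, b, a is a path. *)
Definition is_path (G : sgraph) (x : G) (s : seq G) : Prop :=
  path (@adj G) x s /\
  forall i j : nat, (i < j <= size s)%N ->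
    nth x (x :: s) i = nth x (x :: s) j -> i = 0%N /\ j = size s.

Definition is_cycle (G : sgraph) (x : G) (s : seq G) : Prop :=
  is_path x s /\ last x s = x.

Definition hamiltonian (G : sgraph) : Prop :=
  exists (x : G) (s : seq G), is_cycle x s /\ forall v : G, v \in x :: s.

Section NonZeroComponentGraph.

Variables (F : finFieldType) (V : vectType F) (n : nat) (alpha : n.-tuple V).

Definition nzc_vertex := {v : V | v != 0}.

(* coord alpha i v is the coefficient of alpha_i in v only when alpha is a basis. *)
Definition nzc_adj (a b : nzc_vertex) : bool :=
  (a != b) &&
  [exists i : 'I_n, (coord alpha i (val a) != 0) && (coord alpha i (val b) != 0)].

Lemma nzc_adj_sym : symmetric nzc_adj.
Proof.
move=> a b; rewrite /nzc_adj eq_sym; congr (_ && _).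
by apply: eq_existsb => i; rewrite andbC.
Qed.

Lemma nzc_adj_irrefl : irreflexive nzc_adj.
Proof. by move=> a; rewrite /nzc_adj eqxx. Qed.

Definition nzc_graph : sgraph := SGraph nzc_adj_sym nzc_adj_irrefl.

End NonZeroComponentGraph.

(* Main.v *)
Require Import Defs.
From HB Require Import structures.
From mathcomp Require Import all_boot all_order all_algebra.
From mathcomp Require Import finfield.

Import GRing.Theory.
Local Open Scope ring_scope.

(** Fix a coordinate [i0], and let [P] be the clique of vectors whose
    [i0]-coordinate is nonzero.  Sort the nonzero vectors into classes according
    to the first nonzero coordinate other than [i0]; the vectors without any such
    coordinate, i.e. the nonzero multiples of the [i0]-th basis vector, form one
    more class.  Each class is a clique: its members share either that coordinate
    or the coordinate [i0].  Moreover each class contains two distinct elements of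
    [P], because the class of a vector does not change when its [i0]-coordinate is
    replaced by [1] or by a scalar [c] other than [0] and [1]; such a [c] exists
    since the field has more than two elements.

    A Hamiltonian cycle now visits the classes one at a time, entering and leaving
    each of them through two different elements of [P]: inside a class all moves
    are legal, and so are the moves from class to class, which stay in [P].  The
    graph-theoretic half of this argument is [hamiltonian_of_clique_classes]; it
    applies to any graph with such a system of cliques. *)

(** * Closed walks and Hamiltonian cycles *)

(** Distinctness of consecutive vertices comes for free in a duplicate-free
    sequence with at least two entries, so the cyclic order may be built with
    the reflexive closure of adjacency. *)
Lemma hamiltonian_of_cycle (G : sgraph) (s : seq G) :
  uniq s -> (1 < size s)%N -> (forall v, v \in s) ->
  cycle (fun x y => (x == y) || adj x y) s -> hamiltonian G.
Proof.
case: s => [//|y s] us s_gt1 s_all /= cyc.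
have inj i j : (i < j <= size (rcons s y))%N ->
    nth y (y :: rcons s y) i = nth y (y :: rcons s y) j ->
    i = 0%N /\ j = size (rcons s y).
  rewrite -rcons_cons !nth_rcons size_rcons /= => /andP[ij jle].
  rewrite (leq_trans ij jle); move: jle; rewrite leq_eqVlt.
  case/predU1P=> [j_last | jlt].
    (* the last position holds y again, which otherwise occurs only at 0 *)
    rewrite j_last ltnn eqxx => eq_y; split=> //; apply/eqP.
    rewrite -(nth_uniq y _ _ us) /= ?eq_y //.
    by rewrite -[X in (_ < X)%N]j_last.
  rewrite jlt => /eqP; rewrite nth_uniq //= ?(ltn_trans ij jlt) //.
  by move=> /eqP eq_ij; rewrite eq_ij ltnn in ij.
exists y, (rcons s y); split; last first.
  by move=> v; rewrite inE mem_rcons inE -in_cons s_all orbT.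
split; last by rewrite last_rcons.
split=> //; apply/(pathP y) => i ilt.
have /(pathP y)/(_ i ilt)/predU1P[eq_i|//] := cyc.
have [|i0 /eqP] := inj i i.+1 _ eq_i; first by rewrite ltnSn.
rewrite i0 size_rcons eqSS => /eqP s0.
by rewrite /= -s0 in s_gt1.
Qed.

Lemma path_of_clique (T : eqType) (r : rel T) (A : {pred T}) (x : T) (s : seq T) :
  {in A &, forall a b, r a b} -> x \in A -> {subset s <= A} -> path r x s.
Proof.
move=> rA; elim: s x => //= y s IHs x xA sA.
have yA : y \in A by rewrite sA ?mem_head.
by rewrite rA //= IHs // => z zs; rewrite sA // inE zs orbT.
Qed.

(** * Threading a clique through a partition into cliques *)

Section CliqueClasses.

Variables (G : sgraph) (T : eqType) (t : G -> T) (P : pred G) (e : seq G).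
Hypothesis e_all : forall v, v \in e.
Hypothesis P_clique : forall x y, P x -> P y -> x != y -> adj x y.
Hypothesis t_clique : forall x y, t x = t y -> x != y -> adj x y.
Hypothesis P_twice : forall x, exists a b,
  [/\ a != b, P a, P b, t a = t x & t b = t x].

Let r (x y : G) := (x == y) || adj x y.

(** This property is stable under concatenation, which lets the cycle be
    assembled class by class. *)
Let linked (s : seq G) := forall x, P x -> path r x s && P (last x s).

Let r_P : {in P &, forall x y, r x y}.
Proof.
move=> x y Px Py; rewrite /r; case: eqVneq => //= xy; exact: P_clique.
Qed.

Let r_t x y : t x = t y -> r x y.
Proof. by move=> txy; rewrite /r; case: eqVneq => //= xy; apply: t_clique. Qed.

Let linked_cat s1 s2 : linked s1 -> linked s2 -> linked (s1 ++ s2).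
Proof.
move=> l1 l2 x Px; have /andP[p1 P1] := l1 x Px.
by rewrite cat_path last_cat p1; apply: l2.
Qed.

(** One visit of the class of [x]: enter at [a], leave at [b], both in [P], with
    the remaining members of the class between them in any order. *)
Let class_seq x : exists s,
  [/\ linked s, uniq s & forall v, (v \in s) = (t v == t x)].
Proof.
have [a [b [ab Pa Pb ta tb]]] := P_twice x.
pose m := [seq v <- undup e | [&& t v == t x, v != a & v != b]].
have mE v : (v \in m) = [&& t v == t x, v != a & v != b].
  by rewrite mem_filter mem_undup e_all andbT.
exists (a :: rcons m b); split.
- move=> z Pz; rewrite /= last_rcons Pb andbT r_P //=.
  apply: (@path_of_clique _ _ [pred v | t v == t x]); rewrite ?inE ?ta //.
    by move=> u v /eqP tu /eqP tv; apply: r_t; rewrite tu tv.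
  by move=> v; rewrite mem_rcons inE mE => /predU1P[->|/and3P[]//]; rewrite inE tb.
- rewrite /= mem_rcons inE negb_or ab rcons_uniq !mE !eqxx !andbF /=.
  by rewrite filter_uniq ?undup_uniq.
move=> v; rewrite inE mem_rcons inE mE.
case: (eqVneq v a) => [->|va] /=; first by rewrite ta eqxx.
case: (eqVneq v b) => [->|vb] /=; first by rewrite tb eqxx.
by rewrite andbT.
Qed.

Let classes_seq (xs : seq G) : exists s,
  [/\ linked s, uniq s & forall v, (v \in s) = (t v \in map t xs)].
Proof.
elim: xs => [|x xs [s [ls us sE]]]; first by exists [::]; split=> // x Px.
have [xs_x | xs_x] := boolP (t x \in map t xs).
  exists s; split=> // v; rewrite sE inE.
  by case: eqVneq => // ->; rewrite xs_x.
have [s1 [l1 u1 s1E]] := class_seq x.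
exists (s1 ++ s); split; first exact: linked_cat.
  rewrite cat_uniq u1 us andbT; apply/hasPn => v.
  by rewrite sE /= s1E; apply: contraL => /eqP ->.
by move=> v; rewrite mem_cat s1E sE inE.
Qed.

Lemma hamiltonian_of_clique_classes : G -> hamiltonian G.
Proof.
move=> x0; have [a [b [ab Pa _ _ _]]] := P_twice x0.
have [s [ls us sE]] := classes_seq e.
have s_all v : v \in s by rewrite sE map_f.
apply: (@hamiltonian_of_cycle _ s) => //.
  have: (size [:: a; b] <= size s)%N; last by [].
  by apply: uniq_leq_size => [|v _ //]; rewrite /= inE ab.
(* linked s, used twice: the last entry is in P, hence may precede the first *)
rewrite (cycle_path a).
by have /andP[_ /ls/andP[]] := ls a Pa.
Qed.

End CliqueClasses.

(** * Coordinates *)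

Lemma exists_neq01 (F : finFieldType) : (2 < #|F|)%N ->
  exists c : F, (c != 0) && (c != 1).
Proof.
move=> F_gt2; apply/existsP; apply: contraLR F_gt2 => /existsPn no_c.
rewrite -leqNgt; apply: leq_trans (card_size [:: 0; 1 : F]).
apply: subset_leq_card; apply/subsetP => c _.
by have := no_c c; rewrite !inE -negb_or negbK.
Qed.

Lemma coord_basis_neq0 {F : fieldType} {V : vectType F} {n : nat}
    {alpha : n.-tuple V} {v : V} :
  basis_of {: V} alpha -> v != 0 -> exists i, coord alpha i v != 0.
Proof.
move=> ab v0; apply/existsP; apply: contraNT v0 => /existsPn all0.
rewrite (coord_basis ab (memvf v)) big1 // => i _.
by have := all0 i; rewrite negbK => /eqP ->; rewrite scale0r.
Qed.

Definition set_coord {F : fieldType} {V : vectType F} {n : nat}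
    (alpha : n.-tuple V) (i0 : 'I_n) (c : F) (v : V) : V :=
  v + (c - coord alpha i0 v) *: alpha`_i0.

Lemma coord_set_coord {F : fieldType} {V : vectType F} {n : nat}
    (alpha : n.-tuple V) (i0 i : 'I_n) (c : F) (v : V) :
  free alpha ->
  coord alpha i (set_coord alpha i0 c v) = if i == i0 then c else coord alpha i v.
Proof.
move=> fa; rewrite /set_coord linearD linearZ /= coord_free // [_ == i]eq_sym.
by case: eqVneq => [->|_]; rewrite ?mulr1 ?mulr0 ?addr0 // addrC subrK.
Qed.

Theorem theorem5p3 (F : finFieldType) (q : nat) (hq : #|F| = q)
    (n : nat) (hn : (1 <= n)%N)
    (V : vectType F) (hV : \dim {: V} = n)
    (alpha : n.-tuple V) (halpha : basis_of {: V} alpha)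
    (hq2 : (2 < q)%N) :
  hamiltonian (nzc_graph alpha).
Proof.
have fa := basis_free halpha.
rewrite -hq in hq2; have [c /andP[c0 c1]] := exists_neq01 _ hq2.
pose i0 : 'I_n := Ordinal hn.
pose t (v : nzc_graph alpha) := [pick i | (i != i0) && (coord alpha i (val v) != 0)].
pose P (v : nzc_graph alpha) := coord alpha i0 (val v) != 0.
have set_neq0 d v : d != 0 -> set_coord alpha i0 d v != 0.
  apply: contraNneq => v0; have := coord_set_coord alpha i0 i0 d v fa.
  by rewrite v0 linear0 eqxx => <-.
pose w d (d0 : d != 0) (v : nzc_graph alpha) : nzc_graph alpha :=
  Sub (set_coord alpha i0 d (val v)) (set_neq0 d (val v) d0).
have t_w d d0 v : t (w d d0 v) = t v.
  apply: eq_pick => i; rewrite SubK coord_set_coord //.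
  by case: (i == i0).
have P_w d d0 v : P (w d d0 v) by rewrite /P SubK coord_set_coord ?eqxx.
(* finvect_type V is V itself, equipped with an enumeration *)
pose e : seq (nzc_graph alpha) := pmap insub (enum {: finvect_type V} : seq V).
apply: (@hamiltonian_of_clique_classes _ _ t P e).
- by move=> v; rewrite mem_pmap_sub (mem_enum {: finvect_type V}).
- by move=> x y Px Py xy; rewrite /= /nzc_adj xy; apply/existsP; exists i0; apply/andP.
- move=> x y txy xy; rewrite /= /nzc_adj xy; apply/existsP.
  move: txy; rewrite /t; case: pickP => [i /andP[_ xi]|x0].
    case: pickP => // j /andP[_ yj] [ij].
    by exists i; rewrite xi ij yj.
  (* neither vector has a nonzero coordinate other than i0 *)
  case: pickP => // y0 _; exists i0.
  have only0 (v : nzc_graph alpha) :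
      (fun i => (i != i0) && (coord alpha i (val v) != 0)) =1 xpred0 ->
      coord alpha i0 (val v) != 0.
    move=> v0; have [i vi] := coord_basis_neq0 halpha (valP v).
    by have := v0 i; rewrite vi andbT => /negbFE/eqP <-.
  by rewrite !only0.
- move=> x; exists (w 1 (oner_neq0 F) x), (w c c0 x).
  split; rewrite ?t_w ?P_w //.
  apply: contraNneq c1 => /(congr1 val); rewrite !SubK => /(congr1 (coord alpha i0)).
  by rewrite !coord_set_coord // eqxx => ->.
have a0 : alpha`_i0 != 0.
  by apply: (free_not0 fa); rewrite mem_nth ?size_tuple.
exact: (Sub alpha`_i0 a0 : nzc_vertex V).
Qed.
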